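(* Let $p$ be a prime and let $n>0$ be an integer such that $p^2\mid n$. Then there exists an infinite finitely presented metabelian group in $\widehat{\mathcal B}_n$, i.e. an infinite finitely presented metabelian group satisfying a positive generalized identity of degree $n$.
   Context: For a group $G$ write $g^x=x^{-1}gx$. A group $G$ satisfies a positive generalized identity of degree $k\ge 1$ if there exist fixed elements $g_1,\dots,g_k\in G$ such that $x^{g_1}x^{g_2}\cdots x^{g_k}=1$ for all $x\in G$. $\widehat{\mathcal B}_k$ denotes the class of groups satisfying a positive generalized identity of degree $k$. *)

(* Defs.v *)
From HB Require Import structures.
From mathcomp Require Import all_boot.
From mathcomp Require Import boolp classical_sets functions cardinality.

Set Implicit Arguments.
Unset Strict Implicit.
Unset Printing Implicit Defensive.

Local Open Scope classical_set_scope.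
Local Open Scope group_scope.

(* Here x ^ y is MathComp's conjugation y^-1 * (x * y), and the ordered product
   is x ^ g 0 * x ^ g 1 * ... * x ^ g (k - 1). *)
Definition positive_generalized_identity (k : nat) (G : groupType) : Prop :=
  (0 < k)%N /\
  exists g : 'I_k -> G, forall x : G, \prod_(i < k) x ^ g i = 1.

Definition is_subgroup (G : groupType) (H : set G) : Prop :=
  H 1 /\ forall x y : G, H x -> H y -> H (x / y).

Definition derived_subgroup (G : groupType) : set G :=
  smallest (@is_subgroup G) [set c | exists x y : G, c = [~ x, y]].

Definition metabelian (G : groupType) : Prop :=
  forall x y : G,
    derived_subgroup x -> derived_subgroup y -> commute x y.

(* The letter (i, b) stands for the i-th generator if b = false and for its
   formal inverse if b = true.  Words represent elements of the free group on
   m generators, two words representing the same element when they are related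
   by [free_eq]. *)
Definition word (m : nat) : Type := seq ('I_m * bool).

Definition letter_inv (m : nat) (a : 'I_m * bool) : 'I_m * bool :=
  (a.1, ~~ a.2).

Definition word_inv (m : nat) (w : word m) : word m :=
  rev (map (@letter_inv m) w).

Inductive free_eq (m : nat) : word m -> word m -> Prop :=
| free_eq_refl w : free_eq w w
| free_eq_sym u v : free_eq u v -> free_eq v u
| free_eq_trans u v w : free_eq u v -> free_eq v w -> free_eq u w
| free_eq_cancel u v a : free_eq (u ++ a :: letter_inv a :: v) (u ++ v).

(* The words representing an element of the normal closure of R in the free
   group on m generators. *)
Inductive normal_closure (m : nat) (R : seq (word m)) : word m -> Prop :=
| nc_relator r : r \in R -> normal_closure R r
| nc_one : normal_closure R [::]
| nc_mul u v :
    normal_closure R u -> normal_closure R v -> normal_closure R (u ++ v)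
| nc_inv u : normal_closure R u -> normal_closure R (word_inv u)
| nc_conj u w :
    normal_closure R u -> normal_closure R (word_inv w ++ u ++ w)
| nc_free_eq u v : free_eq u v -> normal_closure R u -> normal_closure R v.

Definition word_eval (G : groupType) (m : nat) (s : 'I_m -> G) (w : word m) : G :=
  \prod_(a <- w) (if a.2 then (s a.1)^-1 else s a.1).

(* The homomorphism from the free group on m generators sending the i-th
   generator to s i is onto, and its kernel is the normal closure of R. *)
Definition is_presentation (G : groupType) (m : nat) (s : 'I_m -> G)
    (R : seq (word m)) : Prop :=
  (forall x : G, exists w : word m, word_eval s w = x) /\
  (forall w : word m, word_eval s w = 1 <-> normal_closure R w).

Definition finitely_presented (G : groupType) : Prop :=
  exists (m : nat) (s : 'I_m -> G) (R : seq (word m)), is_presentation s R.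

(* Main.v *)
(* The group is Z[zeta] ><| C_p, where zeta is a primitive p-th root of unity
   acting by multiplication.  Writing T for the translations, x^p = 1 for every
   x outside T, because x^p is then a norm 1 + zeta + ... + zeta^(p-1) applied
   to a translation; and for x in T the product of the conjugates of x^p by
   1, t, ..., t^(p-1) is again such a norm.  Hence the product of the
   (x^p)^(t^i), i < p, is 1 for every x, an identity of degree p^2 which can be
   repeated to reach any multiple of p^2.
   To get finite presentability for free, the group is constructed from a
   finite presentation which imposes exactly the relations used above; it is
   infinite because it acts on the complex algebraic numbers by the affine maps
   z |-> z + 1 and z |-> zeta z. *)

From HB Require Import structures.
Require Import Defs.
From mathcomp Require Import all_boot all_algebra all_field.
From mathcomp Require Import boolp classical_sets functions cardinality.

Set Implicit Arguments.
Unset Strict Implicit.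
Unset Printing Implicit Defensive.

Local Open Scope group_scope.

(** * Words, formal inverses and free cancellation *)

Lemma letter_invK (m : nat) : involutive (@letter_inv m).
Proof. by case=> i b; rewrite /letter_inv /= negbK. Qed.

Lemma word_invK (m : nat) : involutive (@word_inv m).
Proof.
move=> w; rewrite /word_inv map_rev revK -map_comp.
by rewrite (eq_map (@letter_invK m)) map_id.
Qed.

Lemma word_inv_cat (m : nat) (u v : word m) :
  word_inv (u ++ v) = word_inv v ++ word_inv u.
Proof. by rewrite /word_inv map_cat rev_cat. Qed.

(** Cancellation goes from the inside out: the left context absorbs the first letter [a], the
    induction hypothesis removes the inner pair, and [a] then stands next to its inverse. The
    contexts [x] and [y] make this usable inside longer words. *)
Lemma free_eq_catV (m : nat) (x u y : word m) :
  free_eq (x ++ u ++ word_inv u ++ y) (x ++ y).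
Proof.
elim: u x y => [|a u IHu] x y; first exact: free_eq_refl.
rewrite -cat1s word_inv_cat -!catA /=.
have := IHu (rcons x a) (letter_inv a :: y); rewrite -!cats1 -!catA /= => h.
exact: free_eq_trans h (free_eq_cancel _ _ _).
Qed.

Lemma free_eq_Vcat (m : nat) (x u y : word m) :
  free_eq (x ++ word_inv u ++ u ++ y) (x ++ y).
Proof. by have := free_eq_catV x (word_inv u) y; rewrite word_invK. Qed.

(** * The group defined by a finite presentation *)

Definition rel_eq (m : nat) (R : seq (word m)) (u v : word m) : bool :=
  `[< normal_closure R (u ++ word_inv v) >].

Lemma rel_eq_refl (m : nat) (R : seq (word m)) : reflexive (rel_eq R).
Proof.
move=> u; apply/asboolP; apply: nc_free_eq (nc_one R).
by have := free_eq_catV [::] u [::]; rewrite /= cats0; apply: free_eq_sym.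
Qed.

Lemma rel_eq_sym (m : nat) (R : seq (word m)) : symmetric (rel_eq R).
Proof.
by move=> u v; apply/idP/idP => /asboolP /nc_inv;
   rewrite word_inv_cat word_invK => h; apply/asboolP.
Qed.

Lemma rel_eq_trans (m : nat) (R : seq (word m)) : transitive (rel_eq R).
Proof.
move=> v u w /asboolP huv /asboolP hvw; apply/asboolP.
apply: nc_free_eq (nc_mul huv hvw); rewrite -catA.
exact: free_eq_Vcat.
Qed.

(** Normality enters through u v v'^-1 u'^-1 = (u (v v'^-1) u^-1) (u u'^-1), a conjugate of one
    given element times the other. *)
Lemma rel_eq_cat (m : nat) (R : seq (word m)) (u u' v v' : word m) :
  rel_eq R u u' -> rel_eq R v v' -> rel_eq R (u ++ v) (u' ++ v').
Proof.
move=> /asboolP hu /asboolP hv; apply/asboolP.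
have := nc_mul (nc_conj (word_inv u) hv) hu.
rewrite word_inv_cat word_invK -!catA => h; apply: nc_free_eq h.
by have := free_eq_Vcat (u ++ v ++ word_inv v') u (word_inv u'); rewrite -!catA.
Qed.

(** The word u^-1 v is freely equal to the conjugate of v u^-1 by v. *)
Lemma rel_eq_inv (m : nat) (R : seq (word m)) (u v : word m) :
  rel_eq R u v -> rel_eq R (word_inv u) (word_inv v).
Proof.
rewrite rel_eq_sym => /asboolP h; apply/asboolP; rewrite word_invK.
have := nc_conj v h; rewrite -catA => h'; apply: nc_free_eq h'.
rewrite catA -(cats0 v) -!catA.
by have := free_eq_Vcat [::] v (word_inv u ++ v); rewrite !cats0.
Qed.

(** [eq_quot] takes a boolean equivalence relation, which is why [rel_eq] reflects the normal
    closure classically. *)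
Definition rel_equiv (m : nat) (R : seq (word m)) : equiv_rel (word m) :=
  EquivRel (rel_eq R) (@rel_eq_refl m R) (@rel_eq_sym m R) (@rel_eq_trans m R).

Definition presented (m : nat) (R : seq (word m)) : Type :=
  {eq_quot (rel_equiv R)}%qT.

HB.instance Definition _ (m : nat) (R : seq (word m)) :=
  Choice.copy (presented R) {eq_quot (rel_equiv R)}%qT.

Definition presented_pi (m : nat) (R : seq (word m)) (w : word m) :
  presented R :=
  (\pi_({eq_quot (rel_equiv R)}) w)%qT.

Lemma presented_piP (m : nat) (R : seq (word m)) (u v : word m) :
  reflect (presented_pi R u = presented_pi R v) (rel_eq R u v).
Proof. exact: (@eqquotP _ (rel_equiv R) {eq_quot (rel_equiv R)}%qT u v). Qed.

Definition presented_repr (m : nat) (R : seq (word m)) (x : presented R) :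
  word m :=
  repr (x : {eq_quot (rel_equiv R)}%qT).

Lemma presented_reprK (m : nat) (R : seq (word m)) :
  cancel (@presented_repr m R) (presented_pi R).
Proof. exact: reprK. Qed.

Lemma rel_eq_repr (m : nat) (R : seq (word m)) (w : word m) :
  rel_eq R (presented_repr (presented_pi R w)) w.
Proof. by apply/presented_piP; rewrite presented_reprK. Qed.

Definition presented_mul (m : nat) (R : seq (word m)) (x y : presented R) :=
  presented_pi R (presented_repr x ++ presented_repr y).

Definition presented_inv (m : nat) (R : seq (word m)) (x : presented R) :=
  presented_pi R (word_inv (presented_repr x)).

Lemma presented_pi_cat (m : nat) (R : seq (word m)) (u v : word m) :
  presented_pi R (u ++ v) = presented_mul (presented_pi R u) (presented_pi R v).
Proof. by apply/presented_piP; rewrite rel_eq_sym rel_eq_cat ?rel_eq_repr. Qed.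

Lemma presented_pi_inv (m : nat) (R : seq (word m)) (w : word m) :
  presented_pi R (word_inv w) = presented_inv (presented_pi R w).
Proof. by apply/presented_piP; rewrite rel_eq_sym rel_eq_inv ?rel_eq_repr. Qed.

Lemma presented_mulA (m : nat) (R : seq (word m)) :
  associative (@presented_mul m R).
Proof.
move=> x y z; rewrite -(presented_reprK x) -(presented_reprK y).
by rewrite -(presented_reprK z) -!presented_pi_cat catA.
Qed.

Lemma presented_mul1 (m : nat) (R : seq (word m)) :
  left_id (presented_pi R [::]) (@presented_mul m R).
Proof. by move=> x; rewrite -(presented_reprK x) -presented_pi_cat. Qed.

Lemma presented_mulr1 (m : nat) (R : seq (word m)) :
  right_id (presented_pi R [::]) (@presented_mul m R).
Proof. by move=> x; rewrite -(presented_reprK x) -presented_pi_cat cats0. Qed.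

Lemma presented_mulVr (m : nat) (R : seq (word m)) :
  right_inverse (presented_pi R [::]) (@presented_inv m R) (@presented_mul m R).
Proof.
move=> x; rewrite -(presented_reprK x) -presented_pi_inv -presented_pi_cat.
by apply/presented_piP/asboolP; rewrite cats0; apply/asboolP/rel_eq_refl.
Qed.

Lemma presented_mulV (m : nat) (R : seq (word m)) :
  left_inverse (presented_pi R [::]) (@presented_inv m R) (@presented_mul m R).
Proof.
move=> x; rewrite -(presented_reprK x) -presented_pi_inv.
have := presented_mulVr (presented_pi R (word_inv (presented_repr x))).
by rewrite -presented_pi_inv word_invK.
Qed.

HB.instance Definition _ (m : nat) (R : seq (word m)) :=
  isGroup.Build (presented R) (@presented_mulA m R) (@presented_mul1 m R)
    (@presented_mulr1 m R) (@presented_mulV m R) (@presented_mulVr m R).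

Lemma word_eval_cons (G : groupType) (m : nat) (s : 'I_m -> G) a w :
  word_eval s (a :: w) = (if a.2 then (s a.1)^-1 else s a.1) * word_eval s w.
Proof. by rewrite /word_eval big_cons. Qed.

(** When each generator is sent to its class, a word evaluates to its own class. So representatives
    give surjectivity, and the kernel is the class of the empty word, that is, the normal
    closure. *)
Lemma exists_presentation (m : nat) (R : seq (word m)) :
  exists (G : groupType) (s : 'I_m -> G), is_presentation s R.
Proof.
exists (presented R : groupType), (fun i => presented_pi R [:: (i, false)]).
have evalE w : word_eval (fun i => presented_pi R [:: (i, false)]) w
    = presented_pi R w.
  elim: w => [|[i b] w IHw]; first by rewrite /word_eval big_nil.
  rewrite word_eval_cons IHw -(cat1s _ w) presented_pi_cat; case: b => //=.
  by rewrite -[LHS]/(presented_mul (presented_inv _) _) -presented_pi_inv.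
split=> [x|w].
  by exists (presented_repr x); rewrite evalE presented_reprK.
rewrite evalE; split=> [/presented_piP/asboolP|h]; first by rewrite cats0.
by apply/presented_piP/asboolP; rewrite cats0.
Qed.

(** * Words acting on a set *)

Definition word_act (m : nat) (T : Type) (f : 'I_m * bool -> T -> T)
    (w : word m) (z : T) : T :=
  foldl (fun z a => f a z) z w.

Lemma word_act_cat (m : nat) (T : Type) (f : 'I_m * bool -> T -> T)
    (u v : word m) z :
  word_act f (u ++ v) z = word_act f v (word_act f u z).
Proof. exact: foldl_cat. Qed.

Lemma word_act_inv (m : nat) (T : Type) (f : 'I_m * bool -> T -> T)
    (fK : forall a, cancel (f a) (f (letter_inv a))) (w : word m) :
  cancel (word_act f w) (word_act f (word_inv w)).
Proof.
elim: w => [|a w IHw] z //.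
by rewrite -cat1s word_inv_cat !word_act_cat IHw /= fK.
Qed.

(** Words acting trivially are closed under all the rules generating the normal closure, because
    letters act invertibly. A word that moves some point is thereby shown to lie outside the normal
    closure. *)
Lemma word_act_nc (m : nat) (T : Type) (f : 'I_m * bool -> T -> T)
    (fK : forall a, cancel (f a) (f (letter_inv a))) (R : seq (word m)) :
    (forall r, r \in R -> word_act f r =1 id) ->
  forall w, normal_closure R w -> word_act f w =1 id.
Proof.
move=> fR w; elim=> {w}.
- exact: fR.
- by [].
- by move=> u v _ hu _ hv z; rewrite word_act_cat hu hv.
- move=> u _ hu z; have hK := word_act_inv fK.
  by rewrite -{1}(hu z) hK.
- move=> u w _ hu z; rewrite !word_act_cat hu.
  by have := word_act_inv fK (word_inv w); rewrite word_invK; apply.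
(* Freely equal words act alike, by induction on [free_eq]. *)
- move=> u v huv _ hu z; rewrite -[RHS](hu z); elim: huv z {hu} => {u v} //.
  + by move=> u v w _ huv _ hvw z; rewrite hvw huv.
  + by move=> u v a z; rewrite !word_act_cat /= fK.
Qed.

(** * The subgroup spanned by the conjugates of one element *)

Lemma smallest_is_subgroup (G : groupType) (X : set G) :
  is_subgroup (smallest (@is_subgroup G) X).
Proof.
split=> [|x y hx hy] H [sH sXH]; first exact: sH.1.
by apply: sH.2; [apply: hx|apply: hy].
Qed.

Lemma is_subgroupV (G : groupType) (H : set G) (x : G) :
  is_subgroup H -> H x -> H x^-1.
Proof. by case=> H1 HF hx; rewrite -(mul1g x^-1); apply: HF. Qed.

Lemma is_subgroupM (G : groupType) (H : set G) (x y : G) :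
  is_subgroup H -> H x -> H y -> H (x * y).
Proof.
by move=> sH hx hy; rewrite -(invgK y); apply: sH.2 => //; apply: is_subgroupV.
Qed.

(** With [a] the translation by 1 and [t] the rotation, this is the translation subgroup; natural
    exponents give all conjugates by powers of [t] once [t] has finite order. *)
Definition conj_span (G : groupType) (a t : G) : set G :=
  smallest (@is_subgroup G) [set x | exists i, x = a ^ (t ^+ i)]%classic.

Lemma conj_span_subgroup (G : groupType) (a t : G) :
  is_subgroup (conj_span a t).
Proof. exact: smallest_is_subgroup. Qed.

Lemma conj_span_gen (G : groupType) (a t : G) (i : nat) :
  conj_span a t (a ^ (t ^+ i)).
Proof. by apply: sub_gen_smallest; exists i. Qed.

Lemma conj_span_base (G : groupType) (a t : G) : conj_span a t a.
Proof. by have := @conj_span_gen G a t 0; rewrite expg0 conjg1. Qed.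

Lemma conj_spanM (G : groupType) (a t x y : G) :
  conj_span a t x -> conj_span a t y -> conj_span a t (x * y).
Proof. exact: (is_subgroupM (conj_span_subgroup a t)). Qed.

Lemma conj_spanV (G : groupType) (a t x : G) :
  conj_span a t x -> conj_span a t x^-1.
Proof. exact: (is_subgroupV (conj_span_subgroup a t)). Qed.

Lemma conj_span_ind (G : groupType) (a t : G) (H : set G) :
    is_subgroup H -> (forall i, H (a ^ (t ^+ i))) ->
  forall x, conj_span a t x -> H x.
Proof. by move=> sH Ha; apply: smallest_sub => // _ [i ->]. Qed.

Lemma centralizer_subgroup (G : groupType) (y : G) :
  is_subgroup [set x | commute y x]%classic.
Proof.
split=> [|x z hx hz] /=; first exact: commute1.
by apply: commuteM => //; apply: commuteV.
Qed.

Lemma conj_span_conj (G : groupType) (a t : G) (i : nat) (x : G) :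
  conj_span a t x -> conj_span a t (x ^ (t ^+ i)).
Proof.
apply: (conj_span_ind (H := [set x | conj_span a t (x ^ (t ^+ i))]%classic)).
  have sA := conj_span_subgroup a t.
  split=> [|y z /= hy hz]; first by rewrite /= conj1g; apply: sA.1.
  by rewrite conjMg conjVg; apply: sA.2.
by move=> k /=; rewrite -conjgM -expgnDr; apply: conj_span_gen.
Qed.

(** The norm relation is required for every [t ^+ j] with 0 < j < p, since any of these can be the
    rotation part of an element. *)
Record twisted_relations (G : groupType) (p : nat) (a t : G) : Prop := {
  twisted_order : t ^+ p = 1;
  twisted_commute : forall i j, (i < p)%N -> (j < p)%N ->
    commute (a ^ (t ^+ i)) (a ^ (t ^+ j));
  twisted_norm : forall j, (0 < j < p)%N ->
    \prod_(0 <= i < p) a ^ (t ^+ (j * i)) = 1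
}.

Lemma expg_mod_order (G : groupType) (p i : nat) (t : G) :
  t ^+ p = 1 -> t ^+ (i %% p) = t ^+ i.
Proof.
by move=> tp; rewrite {2}(divn_eq i p) expgnDr mulnC expgnA tp expg1n mul1g.
Qed.

(** Centralizers are subgroups, so commutation spreads from the generators, first in [y] and then in
    [x]. Exponents are reduced modulo p to fall in the range of [twisted_commute]. *)
Lemma conj_span_commute (G : groupType) (p : nat) (a t x y : G) :
    (0 < p)%N -> twisted_relations p a t ->
  conj_span a t x -> conj_span a t y -> commute x y.
Proof.
move=> p_gt0 [tp tC _] hx hy; have cG := @centralizer_subgroup G.
apply: (conj_span_ind (cG x)) hy => j; apply: commute_sym.
apply: (conj_span_ind (cG _)) hx => i.
rewrite /= -(expg_mod_order i tp) -(expg_mod_order j tp).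
by apply: tC; rewrite ltn_pmod.
Qed.

(* The twisted norm is a homomorphism on the abelian group spanned by the
   conjugates of a, so it is trivial as soon as it is trivial at a. *)
Lemma conj_span_norm (G : groupType) (p j : nat) (a t x : G) :
    twisted_relations p a t -> (0 < j < p)%N ->
  conj_span a t x -> \prod_(0 <= i < p) x ^ (t ^+ (j * i)) = 1.
Proof.
move=> rel j_lt hx.
have p_gt0 : (0 < p)%N by case/andP: j_lt => /ltn_trans; apply.
have sA := conj_span_subgroup a t.
pose N k (y : G) := \prod_(0 <= i < k) y ^ (t ^+ (j * i)).
pose K := [set y | conj_span a t y /\ N p y = 1]%classic.
suff [] : K x by [].
have NA k y : conj_span a t y -> conj_span a t (N k y).
  move=> hy; rewrite /N; elim: k => [|k IHk].
    by rewrite big_nil; apply: sA.1.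
  by rewrite big_nat_recr //=; apply: conj_spanM => //; apply: conj_span_conj.
have NF k y z : conj_span a t y -> conj_span a t z ->
    N k (y / z) = N k y / N k z.
  move=> hy hz; elim: k => [|k IHk]; first by rewrite /N !big_nil divg1.
  have NS u : N k.+1 u = N k u * u ^ (t ^+ (j * k)) by rewrite /N big_nat_recr.
  rewrite !NS IHk conjMg conjVg.
  have hyT := conj_span_conj (j * k) hy.
  have hzT := conj_span_conj (j * k) hz.
  have hNz := NA k z hz.
  move: (y ^ _) (z ^ _) (N k z) hyT hzT hNz => yT zT Nz hyT hzT hNz.
  rewrite invgM -!mulgA; congr (_ * _); rewrite [RHS]mulgA.
  apply: (conj_span_commute p_gt0 rel); first exact: conj_spanV.
  exact: sA.2.
apply: conj_span_ind hx => [|i].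
  split=> [|y z [hy Ny] [hz Nz]].
    split; first exact: sA.1.
    by rewrite /N big1 // => i _; rewrite conj1g.
  by split; [apply: sA.2|rewrite NF // Ny Nz divg1].
split; first exact: conj_span_gen.
(* Powers of [t] commute, so the norm at [a ^ (t ^+ i)] is the norm at [a] conjugated by
   [t ^+ i]. *)
have := congr1 (conjg^~ (t ^+ i)) (twisted_norm rel j_lt).
rewrite conj1g conjg_prod => <-.
by apply: eq_bigr => k _; rewrite -!conjgM -!expgnDr addnC.
Qed.

(** * Normal forms in the semidirect product, and the identity *)

Lemma mulg_conj (G : groupType) (t u b c : G) :
  (t * b) * (u * c) = (t * u) * (b ^ u * c).
Proof. by rewrite /conjg !mulgA mulgK. Qed.

Lemma twisted_expg (G : groupType) (p k : nat) (a t b : G) :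
    (0 < p)%N -> twisted_relations p a t -> conj_span a t b ->
  forall j, (t ^+ j * b) ^+ k =
    t ^+ (j * k) * \prod_(0 <= i < k) b ^ (t ^+ (j * i)).
Proof.
move=> p_gt0 rel hb j; have sA := conj_span_subgroup a t.
set P := fun k => \prod_(0 <= i < k) b ^ (t ^+ (j * i)).
have PS l : P l.+1 = P l * b ^ (t ^+ (j * l)) by rewrite /P big_nat_recr.
have PA l : conj_span a t (P l).
  elim: l => [|l IHl]; first by rewrite /P big_nil; apply: sA.1.
  by rewrite PS; apply: conj_spanM => //; apply: conj_span_conj.
rewrite -/(P k); elim: k => [|k IHk]; first by rewrite /P big_nil muln0 mulg1.
(* [expgS] adds the new factor in front, so [mulg_conj] yields the new conjugate on the left of the
   product; commutativity brings it there on the other side. *)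
rewrite expgS IHk PS (conj_span_commute p_gt0 rel (PA k)); last first.
  exact: conj_span_conj.
by rewrite mulnS expgnDr mulg_conj.
Qed.

Definition twisted_form (G : groupType) (a t x : G) : Prop :=
  exists j b, conj_span a t b /\ x = t ^+ j * b.

Lemma twisted_form_mul (G : groupType) (a t x y : G) :
  twisted_form a t x -> twisted_form a t y -> twisted_form a t (x * y).
Proof.
move=> [j [b [hb ->]]] [k [c [hc ->]]]; exists (j + k)%N, (b ^ (t ^+ k) * c).
split; last by rewrite expgnDr mulg_conj.
by apply: conj_spanM => //; apply: conj_span_conj.
Qed.

Lemma twisted_form_base (G : groupType) (a t b : G) :
  conj_span a t b -> twisted_form a t b.
Proof. by exists 0%N, b; rewrite expg0 mul1g. Qed.

Lemma twisted_form_expg (G : groupType) (a t : G) (j : nat) :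
  twisted_form a t (t ^+ j).
Proof.
by exists j, 1; rewrite mulg1; split=> //; apply: (conj_span_subgroup a t).1.
Qed.

(** Since [u, v] = (v u)^-1 (u v) and both products have rotation part [t ^+ (j + k)], the rotations
    cancel. Commutators thus lie in the abelian subgroup [conj_span a t]. *)
Lemma twisted_metabelian (G : groupType) (p : nat) (a t : G) :
    (0 < p)%N -> twisted_relations p a t -> (forall x, twisted_form a t x) ->
  metabelian G.
Proof.
move=> p_gt0 rel gen; have sA := conj_span_subgroup a t.
suff dA x : derived_subgroup x -> conj_span a t x.
  by move=> x y /dA hx /dA hy; apply: (conj_span_commute p_gt0 rel).
apply: smallest_sub => {x} // _ [x [y ->]].
have [j [b [hb ->]]] := gen x; have [k [c [hc ->]]] := gen y.
have -> u v : [~ u, v] = (v * u)^-1 * (u * v) :> G.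
  by rewrite /commg /conjg invgM !mulgA.
rewrite (mulg_conj (t ^+ k) (t ^+ j) c) (mulg_conj (t ^+ j) (t ^+ k) b).
rewrite -!expgnDr (addnC k j).
have hbk := conj_span_conj k hb; have hcj := conj_span_conj j hc.
move: (b ^ _) (c ^ _) hbk hcj => bk cj hbk hcj.
rewrite invgM -mulgA mulKg.
by apply: conj_spanM; [apply: conj_spanV|]; apply: conj_spanM.
Qed.

Lemma twisted_identity (G : groupType) (p k : nat) (a t : G) :
    (1 < p)%N -> (0 < k)%N -> twisted_relations p a t ->
    (forall x, twisted_form a t x) ->
  positive_generalized_identity (k * p * p) G.
Proof.
move=> p_gt1 k_gt0 rel gen; have p_gt0 := ltnW p_gt1.
have sA := conj_span_subgroup a t; have [tp _ _] := rel.
split; first by rewrite !muln_gt0 k_gt0 p_gt0.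
(* The exponent i %/ p is constant on blocks of length p, so each block multiplies to a conjugate of
   [x ^+ p]. *)
exists (fun i => t ^+ (i %/ p)) => x.
have xpN : \prod_(0 <= i < p) (x ^+ p) ^ (t ^+ i) = 1.
  have [j [b [hb xE]]] := gen x.
  (* Reduction modulo p leaves either a translation or an exponent covered by the norm relations. *)
  have {}xE : x = t ^+ (j %% p) * b by rewrite expg_mod_order.
  have [j0|j_gt0] := posnP (j %% p).
    have hxp : conj_span a t (x ^+ p).
      rewrite xE j0 expg0 mul1g; elim: (p) => [|l IHl]; first exact: sA.1.
      by rewrite expgS; apply: conj_spanM.
    have := conj_span_norm rel (j := 1) p_gt1 hxp.
    by under eq_bigr do rewrite mul1n.
  have -> : x ^+ p = 1.
    rewrite xE (twisted_expg p p_gt0 rel hb) (conj_span_norm rel _ hb).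
      by rewrite mulg1 mulnC expgnA tp expg1n.
    by rewrite j_gt0 ltn_pmod.
  by rewrite big1 // => i _; rewrite conj1g.
rewrite -(big_mkord xpredT (fun i => x ^ (t ^+ (i %/ p)))) big_nat_mul.
rewrite (eq_bigr (fun i => (x ^+ p) ^ (t ^+ i))) => [|i _]; last first.
  rewrite conjXg (eq_big_nat _ _ (F2 := fun=> x ^ (t ^+ i))).
    by rewrite prodg_const_nat mulSn addnK.
  move=> l /andP[il li].
  congr (x ^ (t ^+ _)).
  by apply/eqP; rewrite eqn_leq -ltnS ltn_divLR // li leq_divRL.
(* The k * p conjugates of [x ^+ p] split into k runs of length p, each equal to the product in
   [xpN] because [t ^+ p] is 1. *)
rewrite big_nat_mul big1 // => l _.
rewrite -{1}(add0n (l * p)%N) big_addn mulSn addnK -[RHS]xpN.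
apply: eq_bigr => i _; congr (_ ^ _).
by rewrite expgnDr mulnC expgnA tp expg1n mulg1.
Qed.

(** * Evaluation of words and the cyclotomic presentation *)

Lemma word_eval_cat (G : groupType) (m : nat) (s : 'I_m -> G) (u v : word m) :
  word_eval s (u ++ v) = word_eval s u * word_eval s v.
Proof. by rewrite /word_eval big_cat. Qed.

Lemma word_eval_inv (G : groupType) (m : nat) (s : 'I_m -> G) (w : word m) :
  word_eval s (word_inv w) = (word_eval s w)^-1.
Proof.
elim: w => [|[i b] w IHw]; first by rewrite /word_eval big_nil invg1.
rewrite -cat1s word_inv_cat !word_eval_cat IHw invgM; congr (_ * _).
by rewrite /word_eval !big_cons !big_nil !mulg1; case: b; rewrite /= ?invgK.
Qed.

Lemma word_eval_nseq (G : groupType) (m : nat) (s : 'I_m -> G) (i : 'I_m) k :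
  word_eval s (nseq k (i, false)) = s i ^+ k.
Proof.
elim: k => [|k IHk]; first by rewrite /word_eval big_nil.
by rewrite word_eval_cons IHk expgS.
Qed.

Definition commutator_word (m : nat) (u v : word m) : word m :=
  word_inv u ++ word_inv v ++ u ++ v.

Lemma commutator_word_eval (G : groupType) (m : nat) (s : 'I_m -> G)
    (u v : word m) :
  word_eval s (commutator_word u v) = [~ word_eval s u, word_eval s v].
Proof. by rewrite !word_eval_cat !word_eval_inv. Qed.

Lemma commutator_word_act (m : nat) (T : Type) (f : 'I_m * bool -> T -> T)
    (u v : word m) z :
  word_act f (commutator_word u v) z =
    word_act f v (word_act f u
      (word_act f (word_inv v) (word_act f (word_inv u) z))).
Proof. by rewrite !word_act_cat. Qed.

(* Generators of Z[zeta_p] ><| C_p: the translation by 1 is the letter 0 and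
   the multiplication by zeta_p is the letter 1. *)
Definition translation_word (k : nat) : word 2 := nseq k (ord0, false).

Definition rotation_word (k : nat) : word 2 := nseq k (ord_max, false).

Definition rotated_word (k : nat) : word 2 :=
  word_inv (rotation_word k) ++ translation_word 1 ++ rotation_word k.

Definition norm_word (p j : nat) : word 2 :=
  flatten [seq rotated_word (j * i) | i <- index_iota 0 p].

(** These spell out the three fields of [twisted_relations]; [iota 1 p.-1] lists the exponents from
    1 to p - 1. *)
Definition cyclotomic_relators (p : nat) : seq (word 2) :=
  rotation_word p ::
  [seq commutator_word (rotated_word i) (rotated_word j)
     | i <- iota 0 p, j <- iota 0 p] ++
  [seq norm_word p j | j <- iota 1 p.-1].

Lemma rotated_word_eval (G : groupType) (s : 'I_2 -> G) (k : nat) :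
  word_eval s (rotated_word k) = s ord0 ^ (s ord_max ^+ k).
Proof. by rewrite !word_eval_cat word_eval_inv !word_eval_nseq. Qed.

Lemma cyclotomic_twisted (p : nat) (G : groupType) (s : 'I_2 -> G) :
    (forall r, r \in cyclotomic_relators p -> word_eval s r = 1) ->
  twisted_relations p (s ord0) (s ord_max).
Proof.
move=> rel1; split.
- by rewrite -word_eval_nseq; apply: rel1; rewrite inE eqxx.
- move=> i j ip jp; rewrite -!rotated_word_eval; apply/commgP/eqP.
  rewrite -commutator_word_eval; apply: rel1.
  by rewrite inE mem_cat (allpairs_f (fun i j =>
       commutator_word (rotated_word i) (rotated_word j)))
     ?mem_iota // orbT.
- move=> j jp; have norm1 : word_eval s (norm_word p j) = 1.
    apply: rel1; rewrite inE mem_cat map_f ?orbT // mem_iota.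
    by case: (p) jp => [|q]; rewrite ?ltn0 ?andbF // add1n.
  rewrite -[RHS]norm1 /norm_word; elim: (index_iota 0 p) => [|i l IHl].
    by rewrite /word_eval !big_nil.
  by rewrite big_cons IHl /= word_eval_cat rotated_word_eval.
Qed.

(** Normal forms are closed under products, so single letters suffice; the inverse of the rotation
    is written as its power p - 1. *)
Lemma twisted_form_word_eval (p : nat) (G : groupType) (s : 'I_2 -> G)
    (w : word 2) :
    (0 < p)%N -> s ord_max ^+ p = 1 ->
  twisted_form (s ord0) (s ord_max) (word_eval s w).
Proof.
move=> p_gt0 tp; elim: w => [|[i b] w IHw].
  by rewrite /word_eval big_nil -(expg0 (s ord_max)); apply: twisted_form_expg.
rewrite word_eval_cons; apply: twisted_form_mul => //=.
have -> : i = if i == ord0 then ord0 else ord_max.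
  by apply: val_inj; case: i => [[|[|i]] hi].
case: (i == ord0).
  apply: twisted_form_base; case: b; last exact: conj_span_base.
  by apply: conj_spanV; apply: conj_span_base.
case: b; last by rewrite -(expg1 (s ord_max)); apply: twisted_form_expg.
have -> : (s ord_max)^-1 = s ord_max ^+ p.-1; last exact: twisted_form_expg.
by apply: mulg1_eq; rewrite -expgS prednK.
Qed.

(** * The affine action on algebraic numbers and infinitude *)

Definition cyclotomic_letter (z : algC) (a : 'I_2 * bool) (x : algC) : algC :=
  (if a.1 == ord0 then if a.2 then x - 1 else x + 1
   else if a.2 then x / z else x * z)%R.

Lemma cyclotomic_letterK (z : algC) (z_neq0 : z != 0%R) (a : 'I_2 * bool) :
  cancel (cyclotomic_letter z a) (cyclotomic_letter z (letter_inv a)).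
Proof.
case: a => i b x; rewrite /cyclotomic_letter /=.
by case: (i == ord0); case: b => /=;
  rewrite ?GRing.subrK ?GRing.addrK ?GRing.mulfK ?GRing.divfK.
Qed.

Lemma translation_word_act (z x : algC) (k : nat) :
  word_act (cyclotomic_letter z) (translation_word k) x = (x + k%:R)%R.
Proof.
elim: k x => [|k IHk] x; first by rewrite GRing.addr0.
by rewrite /= IHk /cyclotomic_letter /= -GRing.addrA GRing.nat1r.
Qed.

Lemma rotation_word_act (z x : algC) (k : nat) :
  word_act (cyclotomic_letter z) (rotation_word k) x = (x * z ^+ k)%R.
Proof.
elim: k x => [|k IHk] x; first by rewrite GRing.mulr1.
by rewrite /= IHk /cyclotomic_letter /= -GRing.mulrA -GRing.exprS.
Qed.

(** Letters act from left to right, giving (x / z^k + 1) z^k = x + z^k. *)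
Lemma rotated_word_act (z x : algC) (k : nat) : z != 0%R ->
  word_act (cyclotomic_letter z) (rotated_word k) x = (x + z ^+ k)%R.
Proof.
move=> z0; have zk : (z ^+ k != 0)%R by rewrite GRing.expf_neq0.
have fK := word_act_inv (cyclotomic_letterK z0).
have fI y : word_act (cyclotomic_letter z) (word_inv (rotation_word k)) y
    = (y / z ^+ k)%R.
  by rewrite -{1}(GRing.divfK zk y) -rotation_word_act fK.
rewrite !word_act_cat fI translation_word_act rotation_word_act.
by rewrite GRing.mulrDl GRing.mul1r GRing.divfK.
Qed.

Lemma prim_root_neq0 (z : algC) (p : nat) :
  (0 < p)%N -> p.-primitive_root%R z -> z != 0%R.
Proof.
move=> p_gt0 zp.
apply: contraTneq zp => ->; apply/negP => /prim_expr_order/eqP.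
by rewrite GRing.expr0n gtn_eqF // eq_sym GRing.oner_eq0.
Qed.

(** Geometric series: multiplied by z^j - 1, which is nonzero by primitivity, the sum becomes
    (z^j)^p - 1 = 0. *)
Lemma sum_root_unity (z : algC) (p j : nat) :
    p.-primitive_root%R z -> (0 < j < p)%N ->
  (\sum_(i < p) z ^+ (j * i) = 0)%R.
Proof.
move=> zp /andP[j_gt0 jp].
have zj1 : (z ^+ j - 1 != 0)%R.
  by rewrite GRing.subr_eq0 -(prim_order_dvd zp) gtnNdvd.
apply: (GRing.mulfI zj1); rewrite GRing.mulr0.
under eq_bigr do rewrite GRing.exprM.
rewrite -GRing.subrX1 GRing.exprAC (prim_expr_order zp) GRing.expr1n.
exact: GRing.subrr.
Qed.

(** The three kinds of relator act trivially because z^p = 1, because translations commute, and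
    because the sums of [sum_root_unity] vanish. *)
Lemma cyclotomic_relators_act (z : algC) (p : nat) : (0 < p)%N ->
    p.-primitive_root%R z ->
  forall r, r \in cyclotomic_relators p ->
  word_act (cyclotomic_letter z) r =1 id.
Proof.
move=> p_gt0 zp; have z0 := prim_root_neq0 p_gt0 zp.
have fK := word_act_inv (cyclotomic_letterK z0).
have fI k x : word_act (cyclotomic_letter z) (word_inv (rotated_word k)) x
    = (x - z ^+ k)%R.
  by rewrite -{1}(GRing.subrK (z ^+ k)%R x) -rotated_word_act // fK.
move=> r; rewrite inE mem_cat.
case/or3P=> [/eqP->|/allpairsP[[i j] [_ _ ->]]|/mapP[j jp ->]] x /=.
- by rewrite rotation_word_act (prim_expr_order zp) GRing.mulr1.
- rewrite commutator_word_act !rotated_word_act // !fI.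
  by rewrite GRing.addrAC GRing.subrK GRing.subrK.
- have -> l y : word_act (cyclotomic_letter z)
      (flatten [seq rotated_word (j * i) | i <- l]) y
      = (y + \sum_(i <- l) z ^+ (j * i))%R.
    elim: l y => [|i l IHl] y; first by rewrite big_nil GRing.addr0.
    by rewrite big_cons GRing.addrA -rotated_word_act // -IHl -word_act_cat.
  rewrite big_mkord (sum_root_unity zp) ?GRing.addr0 //.
  by move: jp; rewrite mem_iota add1n prednK.
Qed.

Lemma infinite_cyclotomic (p : nat) (G : groupType) (s : 'I_2 -> G) :
    (0 < p)%N ->
  is_presentation s (cyclotomic_relators p) -> infinite_set [set: G]%classic.
Proof.
move=> p_gt0 [_ ker].
have [z zp] := C_prim_root_exists p_gt0; have z0 := prim_root_neq0 p_gt0 zp.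
(* If the k-th power of the translation is 1, its word acts trivially; but it sends 0 to k, and the
   characteristic is 0. *)
have a_order k : s ord0 ^+ k = 1 -> k = 0%N.
  rewrite -word_eval_nseq => /ker /(word_act_nc (cyclotomic_letterK z0)
    (cyclotomic_relators_act p_gt0 zp)) /(_ 0%R).
  rewrite translation_word_act GRing.add0r => /eqP.
  by rewrite Num.Theory.pnatr_eq0 => /eqP.
have a_inj : injective (fun k => s ord0 ^+ k).
  suff le k l : s ord0 ^+ k = s ord0 ^+ l -> (k <= l)%N.
    by move=> k l e; apply/eqP; rewrite eqn_leq !le.
  move=> e; rewrite leqNgt; apply/negP => lk.
  have /a_order/eqP : s ord0 ^+ (k - l) = 1.
    by rewrite expgnFr ?e ?mulgV // ltnW.
  by rewrite subn_eq0 leqNgt lk.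
(* The powers of the translation embed the natural numbers in the group. *)
move=> Gfin; apply: infinite_nat.
have := inj_card_eq (in2W a_inj : {in [set: nat]%classic &, injective _}).
by move/eq_finite_set => <-; apply: sub_finite_set Gfin.
Qed.

Theorem theorem6p1 (p n : nat) (p_prime : prime p) (n_gt0 : (0 < n)%N)
    (p2_dvd_n : (p ^ 2 %| n)%N) :
  exists G : groupType,
    [/\ infinite_set [set: G]%classic,
        finitely_presented G,
        metabelian G
      & positive_generalized_identity n G].
Proof.
have p_gt1 := prime_gt1 p_prime; have p_gt0 := ltnW p_gt1.
have [G [s pres]] := exists_presentation (cyclotomic_relators p).
have [gen ker] := pres; exists G.
have rel : twisted_relations p (s ord0) (s ord_max).
  by apply: cyclotomic_twisted => r hr; apply/ker/nc_relator.
have form x : twisted_form (s ord0) (s ord_max) x.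
  have [w <-] := gen x.
  exact: (twisted_form_word_eval w p_gt0 (twisted_order rel)).
split.
- exact: infinite_cyclotomic pres.
- by exists 2, s, (cyclotomic_relators p).
- exact: twisted_metabelian rel form.
(* Here n = k * p * p, and n > 0 forces k > 0, so the identity of degree p^2 is repeated k times. *)
- have [k nE] := dvdnP p2_dvd_n; move: n_gt0; rewrite nE expnS expn1 mulnA.
  by rewrite !muln_gt0 p_gt0 !andbT => k_gt0; apply: twisted_identity rel form.
Qed.
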